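(* Let $S$ be a strongly ordered commutative semiring whose order $\le$ is well-founded, and let $T$ be a weighted type graph over $S$. Let $R$ be a set of graph transformation rules partitioned into sets $R^{<}$ and $R^{=}$, such that every rule of $R^{<}$ is strongly decreasing and every rule of $R^{=}$ is non-increasing (with respect to $T$). Then $R$ is terminating if and only if $R^{=}$ is terminating.
   Context: Fix a set $\Lambda$ of edge labels. A graph is $G=\langle V,E,s,t,\ell\rangle$ with finite node set, finite edge set, source/target maps $E\to V$ and labelling $E\to\Lambda$; morphisms preserve source, target and label. A semiring $\langle S,\oplus,\otimes,0,1\rangle$: $\langle S,\oplus,0\rangle$ commutative monoid, $\langle S,\otimes,1\rangle$ monoid, two-sided distributivity, $0$ annihilating; commutative if $\otimes$ is. It is ordered (partial order $\le$) if $x\le y$ implies $x\oplus u\le y\oplus u$, and $x\otimes z\le y\otimes z$, $z\otimes x\le z\otimes y$ for $z\ge0$. It is strongly ordered if additionally $x<y,z<u$ imply $x\oplus z<y\oplus u$, and $z>0,x<y$ imply $x\otimes z<y\otimes z$ and $z\otimes x<z\otimes y$. Well-founded means there is no infinite strictly decreasing sequence $x_0>x_1>\cdots$. A weighted type graph $T$ over $S$ is a graph with weight function $w_T\colon E_T\to S$ and a flower node $\mathit{fl}_T$ such that for every label $A$ there is a loop $e_A$ on $\mathit{fl}_T$ labelled $A$ with $w_T(e_A)>0$. For $t\colon D\to T$, $w_T(t)=\prod_{e\in E_D}w_T(t(e))$ ($\otimes$-product). For $\phi\colon I\to L$ and $t\colon I\to T$, $w_t(\phi)=\sum_{t_L\colon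 L\to T,\ t_L\circ\phi=t} w_T(t_L)$ ($\oplus$-sum). A rule $\rho=L\xleftarrow{\phi_L}I\xrightarrow{\phi_R}R$ consists of two graph morphisms with $I$ discrete (no edges); $G\Rightarrow_\rho H$ means there are a match $m\colon L\to G$ (arbitrary morphism), a graph $C$ and morphisms forming two pushout squares $L\leftarrow I\to C$ / $L\to G\leftarrow C$ and $R\leftarrow I\to C$ / $R\to H\leftarrow C$ (double-pushout rewriting). A set of rules $R$ is terminating if there is no infinite sequence $G_0\Rightarrow_{\rho_0}G_1\Rightarrow_{\rho_1}\cdots$ with all $\rho_i\in R$ (starting from any graph). A rule is non-increasing if $w_{t_I}(\phi_L)\ge w_{t_I}(\phi_R)$ for all $t_I\colon I\to T$, and strongly decreasing if $w_{t_I}(\phi_L)>w_{t_I}(\phi_R)$ for all $t_I\colon I\to T$.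
   Formalization: The formal theorem additionally assumes that every edge weight of the weighted type graph T is at least 0 (w_T(e) ≥ 0 for all edges e); with negative weights allowed, the claim as stated is false. *)

(* Defs.v *)
From HB Require Import structures.
From mathcomp Require Import all_boot all_order all_algebra.

Set Implicit Arguments.
Unset Strict Implicit.
Unset Printing Implicit Defensive.

Import GRing.Theory.
Local Open Scope ring_scope.

Record graph (Lam : eqType) := Graph {
  node : finType;
  edge : finType;
  src : edge -> node;
  tgt : edge -> node;
  lab : edge -> Lam
}.

Section Morphisms.
Variable Lam : eqType.
Implicit Types G H K : graph Lam.

Definition is_hom G H
    (f : {ffun node G -> node H} * {ffun edge G -> edge H}) : bool :=
  [forall e : edge G, [&& src (f.2 e) == f.1 (src e),
                          tgt (f.2 e) == f.1 (tgt e) &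
                          lab (f.2 e) == lab e]].

(* Finite functions with a boolean property: [hom G H] is a finType, so it can
   index a sum, and equality of morphisms is Leibniz equality. *)
Record hom G H := Hom {
  hom_val : {ffun node G -> node H} * {ffun edge G -> edge H};
  hom_valP : is_hom hom_val
}.

HB.instance Definition _ G H := [isSub for @hom_val G H].
HB.instance Definition _ G H := [Finite of hom G H by <:].

Definition hnode G H (f : hom G H) : {ffun node G -> node H} := (hom_val f).1.
Definition hedge G H (f : hom G H) : {ffun edge G -> edge H} := (hom_val f).2.

Fact hcomp_subproof G H K (g : hom H K) (f : hom G H) :
  is_hom ([ffun v => hnode g (hnode f v)], [ffun e => hedge g (hedge f e)]).
Proof.
apply/forallP => e; rewrite /= !ffunE.
have /and3P[/eqP fs /eqP ft /eqP fl] := forallP (hom_valP f) e.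
have /and3P[/eqP gs /eqP gt /eqP gl] := forallP (hom_valP g) (hedge f e).
by apply/and3P; split; apply/eqP; rewrite /hnode /hedge ?gs ?gt ?gl ?fs ?ft ?fl.
Qed.

Definition hcomp G H K (g : hom H K) (f : hom G H) : hom G K :=
  Hom (hcomp_subproof g f).

Definition discrete G : Prop := #|edge G| = 0%N.

Definition is_pushout A B C D
    (f : hom A B) (g : hom A C) (h : hom B D) (k : hom C D) : Prop :=
  hcomp h f = hcomp k g /\
  forall (X : graph Lam) (p : hom B X) (q : hom C X), hcomp p f = hcomp q g ->
    exists! u : hom D X, hcomp u h = p /\ hcomp u k = q.

End Morphisms.

Record rule (Lam : eqType) := Rule {
  lhs : graph Lam;
  itf : graph Lam;
  rhs : graph Lam;
  phiL : hom itf lhs;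
  phiR : hom itf rhs;
  itf_discrete : discrete itf
}.

Definition rewrites (Lam : eqType) (r : rule Lam) (G H : graph Lam) : Prop :=
  exists (m : hom (lhs r) G) (C : graph Lam) (c : hom (itf r) C)
         (g : hom C G) (n : hom (rhs r) H) (h : hom C H),
    is_pushout (phiL r) c m g /\ is_pushout (phiR r) c n h.

Definition terminating (Lam : eqType) (R : rule Lam -> Prop) : Prop :=
  ~ exists (G : nat -> graph Lam) (r : nat -> rule Lam),
      forall i, R (r i) /\ rewrites (r i) (G i) (G i.+1).

Section OrderedSemiring.
(* [comPzSemiRingType] is used because the semiring axioms allow 0 = 1. *)
Variables (S : comPzSemiRingType) (le : rel S).

Definition slt : rel S := fun x y => (x != y) && le x y.

Definition partial_order : Prop :=
  [/\ reflexive le, antisymmetric le & transitive le].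

Definition ordered_semiring : Prop :=
  [/\ partial_order,
      forall x y u, le x y -> le (x + u) (y + u),
      forall x y z, le x y -> le 0 z -> le (x * z) (y * z)
    & forall x y z, le x y -> le 0 z -> le (z * x) (z * y)].

Definition strongly_ordered_semiring : Prop :=
  [/\ ordered_semiring,
      forall x y z u, slt x y -> slt z u -> slt (x + z) (y + u),
      forall x y z, slt 0 z -> slt x y -> slt (x * z) (y * z)
    & forall x y z, slt 0 z -> slt x y -> slt (z * x) (z * y)].

Definition well_founded_order : Prop :=
  ~ exists x : nat -> S, forall i, slt (x i.+1) (x i).

End OrderedSemiring.

Record weighted_type_graph (Lam : eqType) (S : comPzSemiRingType)
    (le : rel S) := WeightedTypeGraph {
  wgraph :> graph Lam;
  weight : edge wgraph -> S;
  flower : node wgraph;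
  flower_loop : forall A : Lam, exists e : edge wgraph,
    [/\ src e = flower, tgt e = flower, lab e = A & slt le 0 (weight e)]
}.

Section Weights.
Variables (Lam : eqType) (S : comPzSemiRingType) (le : rel S).
Variable T : weighted_type_graph Lam le.

Definition hom_weight (D : graph Lam) (t : hom D T) : S :=
  \prod_(e : edge D) weight (hedge t e).

Definition ext_weight (I L : graph Lam) (phi : hom I L) (t : hom I T) : S :=
  \sum_(tL : hom L T | hcomp tL phi == t) hom_weight tL.

Definition non_increasing (r : rule Lam) : Prop :=
  forall tI : hom (itf r) T,
    le (ext_weight (phiR r) tI) (ext_weight (phiL r) tI).

Definition strongly_decreasing (r : rule Lam) : Prop :=
  forall tI : hom (itf r) T,
    slt le (ext_weight (phiR r) tI) (ext_weight (phiL r) tI).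

End Weights.

(* Main.v *)
(** For a graph [G] let [W G] be the sum of the weights of all morphisms
    [G -> T].  If [G] is a pushout of [L <- I -> C] with [I] discrete, then the
    edges of [G] are those of [L] and [C] together, so that [W G] is the sum
    over [tC : C -> T] of the weight of [tC] times the weight of [I -> L] at
    the restriction of [tC] to [I].  Comparing the two pushouts of a rewriting
    step term by term, a step of a non-increasing rule does not increase [W].
    For a strongly decreasing rule each term either decreases strictly or is
    [0] on both sides, and the term of the morphism sending [C] to the flower
    node decreases strictly; hence [W] decreases strictly.  Well-foundedness
    leaves only finitely many steps of strongly decreasing rules. *)

From mathcomp Require Import all_boot all_order all_algebra.
From Stdlib Require Import Classical.
Require Import Defs.

Set Implicit Arguments.
Unset Strict Implicit.
Unset Printing Implicit Defensive.

Import GRing.Theory.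
Local Open Scope ring_scope.

(** * Edges and weights of pushouts over a discrete interface *)

Section Pushout.
Variable Lam : eqType.
Implicit Types A B C D G H K : graph Lam.

Lemma hom_ext G H (f g : hom G H) :
  hnode f =1 hnode g -> hedge f =1 hedge g -> f = g.
Proof.
rewrite /hnode /hedge => fgn fge; apply: val_inj => /=.
case: (hom_val f) (hom_val g) fgn fge => [f1 f2] [g1 g2] /= /ffunP -> /ffunP ->.
by [].
Qed.

Lemma hcompA A B C D (f : hom C D) (g : hom B C) (h : hom A B) :
  hcomp f (hcomp g h) = hcomp (hcomp f g) h.
Proof. by apply: hom_ext => x; rewrite /hnode /hedge /= !ffunE. Qed.

Lemma hedge_comp G H K (g : hom H K) (f : hom G H) e :
  hedge (hcomp g f) e = hedge g (hedge f e).
Proof. by rewrite /hedge /= ffunE. Qed.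

Lemma lab_hedge G H (f : hom G H) e : lab (hedge f e) = lab e.
Proof. by have /and3P[_ _ /eqP] := forallP (hom_valP f) e. Qed.

Lemma discrete_no_edge G : discrete G -> edge G -> False.
Proof. by move/card0_eq => dG e; have := dG e. Qed.

(* Morphisms into a one-node graph are label-preserving maps of edges: testing
   the universal property on such graphs determines the edges of a pushout. *)
Definition bouquet (E : finType) (l : E -> Lam) : graph Lam :=
  @Graph Lam unit E (fun=> tt) (fun=> tt) l.

Fact to_bouquet_subproof G (E : finType) (l : E -> Lam) (f : edge G -> E)
    (fl : forall e, l (f e) = lab e) :
  @is_hom _ G (bouquet l) ([ffun=> tt], [ffun e => f e]).
Proof. by apply/forallP => e; rewrite /= !ffunE /= fl !eqxx. Qed.

Definition to_bouquet G (E : finType) (l : E -> Lam) (f : edge G -> E)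
    (fl : forall e, l (f e) = lab e) : hom G (bouquet l) :=
  Hom (to_bouquet_subproof fl).

Lemma hedge_to_bouquet G (E : finType) (l : E -> Lam) (f : edge G -> E)
    (fl : forall e, l (f e) = lab e) e :
  hedge (to_bouquet fl) e = f e.
Proof. by rewrite /hedge /= ffunE. Qed.

Lemma bouquet_hom_ext G (E : finType) (l : E -> Lam) (f g : hom G (bouquet l)) :
  hedge f =1 hedge g -> f = g.
Proof. by apply: hom_ext => x; case: (hnode f x) (hnode g x) => [] []. Qed.

Variables (I L C G : graph Lam) (phi : hom I L) (c : hom I C).
Variables (m : hom L G) (k : hom C G).
Hypotheses (dI : discrete I) (po : is_pushout phi c m k).

Definition pushout_edge (e : edge L + edge C) : edge G :=
  match e with inl e => hedge m e | inr e => hedge k e end.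

Lemma pushout_edge_bij : bijective pushout_edge.
Proof.
pose labLC (e : edge L + edge C) := lab (pushout_edge e).
have labl e : labLC (inl e) = lab e by exact: lab_hedge.
have labr e : labLC (inr e) = lab e by exact: lab_hedge.
(* As [I] has no edges, the two injections into the bouquet on [edge L + edge C] agree on it; the
   mediating morphism [u] supplies the inverse. *)
have [] := po.2 _ (to_bouquet labl) (to_bouquet labr).
  by apply: bouquet_hom_ext => e; case: (discrete_no_edge dI e).
move=> u [[um uk] _].
have labu e : lab (pushout_edge (hedge u e)) = lab e by exact: (lab_hedge u).
have uK : cancel pushout_edge (hedge u).
  by case=> e; apply: etrans (esym (hedge_comp u _ e)) _;
    rewrite ?um ?uk hedge_to_bouquet.
exists (hedge u) => // e.
(* The identity on edges and [pushout_edge] after [hedge u] both mediate into the bouquet on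
   [edge G], so uniqueness identifies them. *)
have labid (x : edge G) : lab x = lab x by [].
pose v := to_bouquet labid; pose v' := to_bouquet labu.
have [|w [_ wP]] := po.2 _ (hcomp v m) (hcomp v k).
  by rewrite -!hcompA po.1.
have wv : w = v by apply: wP.
have wv' : w = v'.
  apply: wP; split; apply: bouquet_hom_ext => x;
    rewrite !hedge_comp !hedge_to_bouquet.
    exact: congr1 _ (uK (inl x)).
  exact: congr1 _ (uK (inr x)).
have := congr1 (fun f => hedge f e) (etrans (esym wv') wv).
by rewrite !hedge_to_bouquet.
Qed.

Variables (S : comPzSemiRingType) (le : rel S) (T : weighted_type_graph Lam le).

Definition graph_weight (D : graph Lam) : S := \sum_(t : hom D T) hom_weight t.

Lemma pushout_hom_weight (t : hom G T) :
  hom_weight t = hom_weight (hcomp t m) * hom_weight (hcomp t k).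
Proof.
rewrite /hom_weight (reindex pushout_edge) /=; last exact/onW_bij/pushout_edge_bij.
rewrite big_sumType /=; congr (_ * _); apply: eq_bigr => e _;
  by rewrite hedge_comp.
Qed.

(** The universal property matches morphisms from [G] to [T] with pairs [tC], [tL] that agree on
    [I]. The sum is grouped by [tC], then by [tL], which leaves one morphism [u] per pair. *)
Lemma pushout_graph_weight :
  graph_weight G = \sum_(t : hom C T) ext_weight phi (hcomp t c) * hom_weight t.
Proof.
rewrite /graph_weight (partition_big (fun t : hom G T => hcomp t k) predT) //=.
apply: eq_bigr => tC _; rewrite /ext_weight mulr_suml.
rewrite (partition_big (fun t : hom G T => hcomp t m)
           (fun tL => hcomp tL phi == hcomp tC c)) /=; last first.
  by move=> t /eqP <-; rewrite -!hcompA po.1.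
apply: eq_bigr => tL /eqP tLC.
have [u [[um uk] uP]] := po.2 _ _ _ tLC.
rewrite (big_pred1 u) => [|t]; first by rewrite pushout_hom_weight um uk.
apply/andP/eqP => [[/eqP tk /eqP tm]|->]; first by rewrite (uP t).
by rewrite um uk.
Qed.

End Pushout.

(** * Sums and products in strongly ordered semirings *)

Section OrderedSums.
Variables (S : comPzSemiRingType) (le : rel S).
Hypothesis hS : strongly_ordered_semiring le.

Lemma ordered_refl : reflexive le.
Proof. by case: hS => [[[]]]. Qed.

Lemma ordered_trans : transitive le.
Proof. by case: hS => [[[]]]. Qed.

Lemma slt_le_trans y x z : slt le x y -> le y z -> slt le x z.
Proof.
case: hS => [[[_ anti trans] _ _ _] _ _ _] /andP[nxy lxy] lyz.
rewrite /slt (trans _ _ _ lxy lyz) andbT; apply: contraNneq nxy => xz.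
by apply/eqP/anti; rewrite lxy xz.
Qed.

Lemma le_add x y z u : le x y -> le z u -> le (x + z) (y + u).
Proof.
case: hS => [[_ addP _ _] _ _ _] lxy lzu.
apply: ordered_trans (addP _ _ z lxy) _.
by rewrite ![y + _]addrC; exact: addP.
Qed.

Lemma le_sum (J : finType) (a b : J -> S) :
  (forall j, le (a j) (b j)) -> le (\sum_j a j) (\sum_j b j).
Proof.
move=> lab; apply: (big_ind2 le) => //; first exact: ordered_refl.
by move=> *; exact: le_add.
Qed.

(** Factors are multiplied in one at a time, because [0 <= 1] is not an axiom and the empty product
    is [1]. *)
Lemma le_mul_prod (J : finType) (w : J -> S) x y :
  (forall j, le 0 (w j)) -> le x y -> le (x * \prod_j w j) (y * \prod_j w j).
Proof.
case: hS => [[_ _ mulP _] _ _ _] w0.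
apply: (big_rec (fun p => le x y -> le (x * p) (y * p))) => [|j p _ IH lxy].
  by rewrite !mulr1.
by rewrite mulrCA [y * _]mulrCA ![w j * _]mulrC; apply/mulP/w0/IH.
Qed.

Lemma slt_mul_prod (J : finType) (w : J -> S) x y :
  (forall j, slt le 0 (w j)) -> slt le x y ->
  slt le (x * \prod_j w j) (y * \prod_j w j).
Proof.
case: hS => [_ _ mulP _] w0.
apply: (big_rec (fun p => slt le x y -> slt le (x * p) (y * p))) => [|j p _ IH lxy].
  by rewrite !mulr1.
by rewrite mulrCA [y * _]mulrCA ![w j * _]mulrC; apply/mulP/IH.
Qed.

(* Adding the same non-zero summand to both sides need not preserve [slt] in a
   strongly ordered semiring (take max for addition), so equality is only
   allowed at [0]. *)
Definition slt_or_zero (x y : S) : Prop := slt le x y \/ x = 0 /\ y = 0.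

Lemma slt_add_or_zero x y z u :
  slt le x y -> slt_or_zero z u -> slt le (x + z) (y + u).
Proof.
case: hS => [_ addP _ _] lxy [lzu|[-> ->]]; first exact: addP.
by rewrite !addr0.
Qed.

Lemma slt_or_zero_add x y z u :
  slt_or_zero x y -> slt_or_zero z u -> slt_or_zero (x + z) (y + u).
Proof.
move=> [lxy lzu|[-> ->]]; first by left; exact: slt_add_or_zero.
by rewrite !add0r.
Qed.

Lemma slt_sum (J : finType) (a b : J -> S) (j0 : J) :
  (forall j, slt_or_zero (a j) (b j)) -> slt le (a j0) (b j0) ->
  slt le (\sum_j a j) (\sum_j b j).
Proof.
move=> lab lj0; rewrite (bigD1 j0) //= [X in slt le _ X](bigD1 j0) //=.
apply: slt_add_or_zero => //.
apply: (big_ind2 slt_or_zero) => //; first by right.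
by move=> *; exact: slt_or_zero_add.
Qed.

(** One zero factor annihilates both sides; otherwise all factors are strictly positive. *)
Lemma mul_prod_slt_or_zero (J : finType) (w : J -> S) x y :
  (forall j, le 0 (w j)) -> slt le x y ->
  slt_or_zero (x * \prod_j w j) (y * \prod_j w j).
Proof.
move=> w0 lxy; have [[j /eqP wj]|w_neq0] := altP (@existsP _ (fun j => w j == 0)).
  by right; rewrite (bigD1 j) //= wj mul0r !mulr0.
left; apply: slt_mul_prod => // j; rewrite /slt w0 andbT eq_sym.
by apply: contra w_neq0 => wj; apply/existsP; exists j.
Qed.

Lemma finitely_many_drops (x : nat -> S) : well_founded_order le ->
  (forall i, le (x i.+1) (x i)) ->
  exists n, forall i, (n <= i)%N -> ~~ slt le (x i.+1) (x i).
Proof.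
move=> wf x_le; apply: NNPP => no_n.
have drop n : exists i, (n <= i)%N && slt le (x i.+1) (x i).
  apply: NNPP => no_i; apply: no_n; exists n => i ni.
  by apply/negP => xi; apply: no_i; exists i; rewrite ni.
have x_anti n d : le (x (n + d)%N) (x n).
  elim: d => [|d IH]; first by rewrite addn0 ordered_refl.
  by rewrite addnS; apply: ordered_trans (x_le _) IH.
pose s n := ex_minn (drop n).
have sP n : (n <= s n)%N /\ slt le (x (s n).+1) (x (s n)).
  by rewrite /s; case: ex_minnP => i /andP[].
(* [s i] is the first drop from [i] on; restarting just after it gives a strictly decreasing
   subsequence. *)
apply: wf; exists (fun n => x (iter n (fun i => (s i).+1) 0%N)) => n /=.
set i := iter _ _ _; have [si xi] := sP i.
by apply: slt_le_trans xi _; have := x_anti i (s i - i)%N; rewrite subnKC.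
Qed.

End OrderedSums.

(** * Effect of a rewriting step on the graph weight *)

Section Steps.
Variables (Lam : eqType) (S : comPzSemiRingType) (le : rel S).
Variable T : weighted_type_graph Lam le.
Hypothesis hS : strongly_ordered_semiring le.
Hypothesis hT : forall e : edge T, le 0 (weight e).

(** All of [D] collapses onto the flower node, each edge going to a positive loop with its label. *)
Lemma flower_hom (D : graph Lam) :
  exists t : hom D T, forall e, slt le 0 (weight (hedge t e)).
Proof.
have loop A : exists e : edge T,
    [&& src e == flower T, tgt e == flower T, lab e == A & slt le 0 (weight e)].
  by have [e [es et el w0]] := flower_loop T A; exists e; rewrite es et el !eqxx.
pose f : {ffun node D -> node T} * {ffun edge D -> edge T} :=
  ([ffun=> flower T], [ffun e => xchoose (loop (lab e))]).
have f_hom : is_hom f.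
  apply/forallP => e; rewrite /= !ffunE.
  by have /and4P[-> -> ->] := xchooseP (loop (lab e)).
exists (Hom f_hom) => e; rewrite /hedge /= ffunE.
by have /and4P[] := xchooseP (loop (lab e)).
Qed.

Lemma non_increasing_step r G H : non_increasing T r -> rewrites r G H ->
  le (graph_weight T H) (graph_weight T G).
Proof.
move=> rP [m [C [c [g [n [h [poG poH]]]]]]].
rewrite (pushout_graph_weight (itf_discrete r) poG).
rewrite (pushout_graph_weight (itf_discrete r) poH).
by apply: le_sum => // t; apply: le_mul_prod.
Qed.

Lemma strongly_decreasing_step r G H : strongly_decreasing T r ->
  rewrites r G H -> slt le (graph_weight T H) (graph_weight T G).
Proof.
move=> rP [m [C [c [g [n [h [poG poH]]]]]]].
rewrite (pushout_graph_weight (itf_discrete r) poG).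
rewrite (pushout_graph_weight (itf_discrete r) poH).
have [t0 t0_gt0] := flower_hom C.
apply: (slt_sum hS (j0 := t0)) => [t|]; first exact: mul_prod_slt_or_zero.
exact: slt_mul_prod.
Qed.

End Steps.

Theorem theorem2 (Lam : eqType) (S : comPzSemiRingType) (le : rel S)
    (T : weighted_type_graph Lam le) (R Rlt Req : rule Lam -> Prop)
    (hS : strongly_ordered_semiring le)
    (hwf : well_founded_order le)
    (hT : forall e : edge T, le 0%R (weight e))
    (hpart : forall r : rule Lam, R r <-> Rlt r \/ Req r)
    (hdisj : forall r : rule Lam, ~ (Rlt r /\ Req r))
    (hlt : forall r : rule Lam, Rlt r -> strongly_decreasing T r)
    (heq : forall r : rule Lam, Req r -> non_increasing T r) :
  terminating R <-> terminating Req.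
Proof.
split=> [termR [G [r step]]|termReq [G [r step]]].
  by apply: termR; exists G, r => i; have [ri Gi] := step i;
    split=> //; apply/hpart; right.
have drop i : Rlt (r i) -> slt le (graph_weight T (G i.+1)) (graph_weight T (G i)).
  by move=> /hlt ri; apply: strongly_decreasing_step ri (step i).2.
have [i|n nP] := finitely_many_drops (x := fun i => graph_weight T (G i)) hS hwf.
  have /hpart[/drop/andP[]//|/heq ri] := (step i).1.
  exact: non_increasing_step ri (step i).2.
(* From index [n] on the weight never drops strictly, so the tail uses only rules of [Req]. *)
apply: termReq; exists (fun i => G (n + i)%N), (fun i => r (n + i)%N) => i.
rewrite addnS; have [/hpart[/drop Gi_gt|ri] Gi] := step (n + i)%N; last by [].
by have /negP[] := nP _ (leq_addr i n).
Qed.
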